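(* Let $a,b\ge1$ be integers with $g=\gcd(a,b)>1$, let $\{0,g\}\subseteq A\subseteq[0,g]$, and let $I=I_A\in\mathcal I^1_{a,b}$. Then $r(I)=1$ if and only if $A=\{0,d,2d,\ldots,(g/d)d=g\}$ with $d=\gcd(A)\ne g$.
   Context: $K$ is a field. For a set of integers $A$ with $\{0,g\}\subseteq A\subseteq[0,g]$, $g=\gcd(a,b)$, put $I_A=(x^{i\frac ag}y^{b-i\frac bg} : i\in A)\subset K[x,y]$. $\mathcal I^1_{a,b}$ is the set of all such ideals $I_A$; equivalently, the set of monomial ideals $I\subset K[x,y]$ having $x^a,y^b$ among their minimal monomial generators and such that $bc+ad=ab$ for every minimal monomial generator $x^cy^d$ of $I$. With $J=(x^a,y^b)$, the reduction number $r(I)$ is the smallest integer $r\ge0$ with $I^{r+1}=JI^r$ (such $r$ exists). $[c,d]$ denotes the set of integers $i$ with $c\le i\le d$, and $\gcd(A)$ is the greatest common divisor of the integers in $A$. *)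

(* Defs.v *)
From HB Require Import structures.
From mathcomp Require Import all_boot all_order all_algebra.
From mathcomp Require Import finmap.
From mathcomp Require Import mpoly.

Set Implicit Arguments.
Unset Strict Implicit.
Unset Printing Implicit Defensive.

Import GRing.Theory.
Local Open Scope ring_scope.

Section Ideals.
Variable R : comNzRingType.
Implicit Types (S I J : R -> Prop) (p : R).

(* A pair u in s contributes the coefficient u.1 times the generator u.2. *)
Definition ideal_gen S : R -> Prop := fun p =>
  exists2 s : seq (R * R),
    (forall u, u \in s -> S u.2) & p = \sum_(u <- s) u.1 * u.2.

Definition ideal_mul I J : R -> Prop :=
  ideal_gen (fun p => exists f h, [/\ I f, J h & p = f * h]).

Fixpoint ideal_exp I (n : nat) : R -> Prop :=
  if n is n'.+1 then ideal_mul I (ideal_exp I n') else fun=> True.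

Definition ideal_eq I J : Prop := forall p, I p <-> J p.

Definition is_reduction_number J I (r : nat) : Prop :=
  ideal_eq (ideal_exp I r.+1) (ideal_mul J (ideal_exp I r)) /\
  forall s : nat, ideal_eq (ideal_exp I s.+1) (ideal_mul J (ideal_exp I s)) ->
    (r <= s)%N.

End Ideals.

Section Monomial.
Variable K : fieldType.

Definition monom_xy (c d : nat) : {mpoly K[2]} :=
  'X_ord0 ^+ c * 'X_ord_max ^+ d.

Definition ideal_xy (a b : nat) : {mpoly K[2]} -> Prop :=
  ideal_gen (fun p => p = monom_xy a 0 \/ p = monom_xy 0 b).

(* The natural-number subtraction is never truncated for i <= gcd(a, b). *)
Definition ideal_of_set (a b : nat) (A : {fset nat}) : {mpoly K[2]} -> Prop :=
  ideal_gen (fun p => exists2 i : nat, i \in A &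
    p = monom_xy (i * (a %/ gcdn a b)) (b - i * (b %/ gcdn a b))).

End Monomial.

Definition gcd_fset (A : {fset nat}) : nat := \big[gcdn/0%N]_(i <- A) i.

(* Main.v *)
Require Import Defs.
From mathcomp Require Import all_boot all_order all_algebra.
From mathcomp Require Import finmap.
From mathcomp Require Import mpoly.
From mathcomp Require Import zify.

(** Every ideal in sight is generated by monomials lying on one segment.  Put
    g = gcd(a, b) and let m(n, t) be the monomial x^(t a/g) y^(n b - t b/g), so
    that m(1, i) m(1, j) = m(2, i + j).  Then I is generated by the m(1, t) with
    t in A, J by m(1, 0) and m(1, g), I^2 by the m(2, t) with t in A + A, and
    J I by the m(2, t) with t in A or in g + A.

    Distinct monomials m(n, t) with the same n do not divide one another: as t
    grows, the x-exponent increases and the y-exponent decreases.  A monomial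
    lies in a monomial ideal only if one of the generators divides it, so an
    inclusion between such ideals is an inclusion between the sets of indices t
    ([seg_ideal_sub]).  Hence I^2 = J I exactly when A + A is contained in the
    union of A and g + A, and I = J exactly when A = {0, g}.  The reduction
    number is 1 when the first equality holds and the second, which is the
    condition r = 0, fails.

    The first condition says that the residues of A modulo g are closed under
    addition, hence form a subgroup of Z/g, because a finite nonempty set closed
    under addition is one.  The subgroups of Z/g are the sets of multiples of
    the divisors of g; thus A consists of the multiples of gcd(A) in [0, g]
    ([sum_closed_multiples]), and A = {0, g} exactly when gcd(A) = g. *)

Set Implicit Arguments.
Unset Strict Implicit.
Unset Printing Implicit Defensive.

Import GRing.Theory.

(** * Ideals given by generators *)

Section Generators.
Variable R : comNzRingType.
Implicit Types (S T I J : R -> Prop) (p q f h : R).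
Local Open Scope ring_scope.

Lemma ideal_gen_in S p : S p -> ideal_gen S p.
Proof.
move=> Sp; exists [:: (1, p)]; last by rewrite big_seq1 mul1r.
by move=> u; rewrite inE => /eqP->.
Qed.

Lemma ideal_genD S p q : ideal_gen S p -> ideal_gen S q -> ideal_gen S (p + q).
Proof.
move=> [s Hs ->] [t Ht ->]; exists (s ++ t); last by rewrite big_cat.
by move=> u; rewrite mem_cat => /orP[/Hs|/Ht].
Qed.

Lemma ideal_gen0 S : ideal_gen S 0.
Proof. by exists [::]; rewrite ?big_nil. Qed.

Lemma ideal_genM S f p : ideal_gen S p -> ideal_gen S (f * p).
Proof.
move=> [s Hs ->]; exists [seq (f * u.1, u.2) | u <- s].
  by move=> _ /mapP[v vs ->] /=; exact: Hs vs.
by rewrite big_map mulr_sumr; apply: eq_bigr => u _; rewrite mulrA.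
Qed.

Lemma ideal_gen_sub S T :
  (forall p, S p -> ideal_gen T p) -> forall p, ideal_gen S p -> ideal_gen T p.
Proof.
move=> ST p [s Hs ->]; rewrite big_seq.
apply: big_ind => [|x y|u /Hs/ST]; first exact: ideal_gen0.
  exact: ideal_genD.
exact: ideal_genM.
Qed.

Lemma ideal_gen_eq S T :
  (forall p, S p <-> T p) -> ideal_eq (ideal_gen S) (ideal_gen T).
Proof. by move=> ST p; split; apply: ideal_gen_sub => q /ST/ideal_gen_in. Qed.

Lemma ideal_eq_trans I J H : ideal_eq I J -> ideal_eq J H -> ideal_eq I H.
Proof. by move=> IJ JH p; rewrite IJ JH. Qed.

Lemma ideal_eq_congr I I' J J' :
  ideal_eq I I' -> ideal_eq J J' -> ideal_eq I J <-> ideal_eq I' J'.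
Proof. by move=> II JJ; split=> IJ p; have := IJ p; rewrite II JJ. Qed.

Lemma ideal_mul_congr I I' J J' :
  ideal_eq I I' -> ideal_eq J J' -> ideal_eq (ideal_mul I J) (ideal_mul I' J').
Proof.
move=> II JJ; apply: ideal_gen_eq => p.
by split=> -[f [h [? ? ->]]]; exists f, h; split=> //; apply/II || apply/JJ.
Qed.

Lemma ideal_mul_gen S T :
  ideal_eq (ideal_mul (ideal_gen S) (ideal_gen T))
           (ideal_gen (fun p => exists f h, [/\ S f, T h & p = f * h])).
Proof.
move=> p; split; apply: ideal_gen_sub => {}p [f [h [Sf Th ->]]]; last first.
  by apply: ideal_gen_in; exists f, h; split=> //; apply: ideal_gen_in.
set U := fun _ => _.
case: Th => s Ts ->; rewrite mulr_sumr big_seq.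
apply: big_ind => [|x y|u /Ts Tu]; first exact: ideal_gen0.
  exact: ideal_genD.
rewrite mulrCA; apply: ideal_genM; case: Sf => t St ->.
rewrite mulr_suml big_seq.
apply: big_ind => [|x y|v /St Sv]; first exact: ideal_gen0.
  exact: ideal_genD.
by rewrite -mulrA; apply: ideal_genM; apply: ideal_gen_in; exists v.2, u.2.
Qed.

Lemma ideal_mul1 S :
  ideal_eq (ideal_mul (ideal_gen S) (fun=> True)) (ideal_gen S).
Proof.
move=> p; split; last first.
  by move=> Sp; apply: ideal_gen_in; exists p, 1; rewrite mulr1.
case=> s Hs ->; rewrite big_seq.
apply: big_ind => [|x y|u /Hs[f [h [Sf _ ->]]]]; first exact: ideal_gen0.
  exact: ideal_genD.
by rewrite [f * h]mulrC; do 2!apply: ideal_genM.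
Qed.

End Generators.

(** A coefficient of a combination of monomials can be nonzero only if it comes
    from one of the summands, which are multiples of generators. *)
Lemma mpolyX_ideal_gen (n : nat) (R : comNzRingType) (E : 'X_{1..n} -> Prop)
    (m : 'X_{1..n}) :
  ideal_gen (fun p : {mpoly R[n]} => exists2 e, E e & p = 'X_[e])%R 'X_[m]%R ->
  exists2 e, E e & exists k, m = (e + k)%MM.
Proof.
case=> s Hs /(congr1 (fun p => p@_m)%R).
rewrite mcoeffX eqxx => /eqP; rewrite eq_sym.
elim: s Hs => [|u s IHs] Hs; first by rewrite big_nil mcoeff0 eq_sym oner_eq0.
rewrite big_cons mcoeffD.
have [->|nz _] := eqVneq ((u.1 * u.2)@_m)%R 0%R.
  by rewrite add0r; apply: IHs => v vs; apply: Hs; rewrite inE vs orbT.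
have [e Ee Du] := Hs u (mem_head _ _); exists e => //.
move: nz; rewrite -mcoeff_msupp Du (perm_mem (msuppMX _ _)).
by case/mapP=> k _ ->; exists k.
Qed.

(** * Monomials on a segment *)

Section Segment.
Variables (K : fieldType) (a b : nat).
Let g := gcdn a b.
Implicit Types (B C : nat -> Prop).

Definition mnm_xy (c d : nat) : 'X_{1..2} :=
  (U_(ord0) *+ c + U_(ord_max) *+ d)%MM.

Lemma monom_xyE c d : monom_xy K c d = 'X_[mnm_xy c d]%R.
Proof. by rewrite /monom_xy mpolyXD !mpolyXn. Qed.

Lemma mnm_xy0 c d : mnm_xy c d ord0 = c.
Proof. by rewrite mnmDE !mulmnE !mnm1E /= mul1n mul0n addn0. Qed.

Lemma mnm_xy1 c d : mnm_xy c d ord_max = d.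
Proof. by rewrite mnmDE !mulmnE !mnm1E /= mul1n mul0n. Qed.

Lemma monom_xyM c d c' d' :
  (monom_xy K c d * monom_xy K c' d')%R = monom_xy K (c + c') (d + d').
Proof. by rewrite /monom_xy mulrACA -!exprD. Qed.

Definition seg_monom (n t : nat) : {mpoly K[2]} :=
  monom_xy K (t * (a %/ g)) (n * b - t * (b %/ g)).

Definition seg_ideal (n : nat) B : {mpoly K[2]} -> Prop :=
  ideal_gen (fun p => exists2 t, B t & p = seg_monom n t).

Lemma seg_monomM n n' t t' : t <= n * g -> t' <= n' * g ->
  (seg_monom n t * seg_monom n' t')%R = seg_monom (n + n') (t + t').
Proof.
have Db : b = g * (b %/ g) by rewrite mulnC divnK // dvdn_gcdr.
move=> le_t le_t'; rewrite monom_xyM -mulnDl; congr monom_xy.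
by rewrite {1 3 5}Db; nia.
Qed.

Lemma seg_ideal_mul n n' B C :
  (forall t, B t -> t <= n * g) -> (forall t, C t -> t <= n' * g) ->
  ideal_eq (ideal_mul (seg_ideal n B) (seg_ideal n' C))
           (seg_ideal (n + n') (fun t => exists i j, [/\ B i, C j & t = i + j])).
Proof.
move=> leB leC; apply: ideal_eq_trans (ideal_mul_gen _ _) _.
apply: ideal_gen_eq => p; split.
  case=> _ [_ [[i Bi ->] [j Cj ->] ->]]; exists (i + j); first by exists i, j.
  by rewrite seg_monomM ?leB ?leC.
case=> _ [i [j [Bi Cj ->]]] ->; exists (seg_monom n i), (seg_monom n' j).
by split; [exists i | exists j | rewrite seg_monomM ?leB ?leC].
Qed.

Lemma ideal_of_setE (A : {fset nat}) :
  ideal_eq (@ideal_of_set K a b A) (seg_ideal 1 (fun t => t \in A)).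
Proof. by apply: ideal_gen_eq => p; rewrite /seg_monom mul1n. Qed.

Lemma ideal_xyE :
  ideal_eq (@ideal_xy K a b) (seg_ideal 1 (fun t => t = 0 \/ t = g)).
Proof.
have D0 : monom_xy K 0 b = seg_monom 1 0.
  by rewrite /seg_monom !mul0n mul1n subn0.
have Dg : monom_xy K a 0 = seg_monom 1 g.
  by rewrite /seg_monom ![g * _]mulnC !divnK ?dvdn_gcdl ?dvdn_gcdr // mul1n subnn.
apply: ideal_gen_eq => p; rewrite D0 Dg; split.
  by case=> ->; [exists g; first right | exists 0; first left].
by case=> t [->|->] ->; [right | left].
Qed.

Hypotheses (a_gt0 : 0 < a) (b_gt0 : 0 < b).

(** Some generator, of index s, divides the monomial.  Comparing x-exponents
    gives s <= t and comparing y-exponents gives t <= s. *)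
Lemma seg_monom_ideal n B t : t <= n * g ->
  seg_ideal n B (seg_monom n t) -> B t.
Proof.
move=> le_t; rewrite /seg_monom monom_xyE => Ht.
have [|_ [s Bs ->] [k Dm]] :=
  @mpolyX_ideal_gen 2 K
    (fun e => exists2 s, B s & e = mnm_xy (s * (a %/ g)) (n * b - s * (b %/ g)))
    _ (ideal_gen_sub _ Ht).
  move=> _ [s Bs ->]; apply: ideal_gen_in; rewrite /seg_monom monom_xyE.
  by eexists; first by exists s.
move: (congr1 (fun m : 'X_{1..2} => m ord0) Dm).
move: (congr1 (fun m : 'X_{1..2} => m ord_max) Dm).
rewrite [RHS]mnmDE !mnm_xy1 => Dy; rewrite [RHS]mnmDE !mnm_xy0 => Dx.
have Db : b = g * (b %/ g) by rewrite mulnC divnK // dvdn_gcdr.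
have ag_gt0 : 0 < a %/ g.
  by rewrite divn_gt0 ?gcdn_gt0 ?a_gt0 // dvdn_leq ?dvdn_gcdl.
have bg_gt0 : 0 < b %/ g.
  by rewrite divn_gt0 ?gcdn_gt0 ?a_gt0 // dvdn_leq ?dvdn_gcdr.
have le_st : s <= t by rewrite -(leq_pmul2r ag_gt0) Dx leq_addr.
(* The truncated subtractions are exact here, so that the y-exponents give
   t <= s. *)
have le_tb : t * (b %/ g) <= n * b by rewrite {2}Db mulnA leq_mul2r le_t orbT.
have le_sb : s * (b %/ g) <= t * (b %/ g) by rewrite leq_mul2r le_st orbT.
have le_ts : t <= s by rewrite -(leq_pmul2r bg_gt0); lia.
suff <- : s = t by [].
by apply/eqP; rewrite eqn_leq le_st.
Qed.

Lemma seg_ideal_sub n B C : (forall t, B t -> t <= n * g) ->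
  (forall p, seg_ideal n B p -> seg_ideal n C p) <-> (forall t, B t -> C t).
Proof.
move=> leB; split=> [sBC t Bt|sBC p].
  apply: seg_monom_ideal; first exact: leB.
  by apply/sBC/ideal_gen_in; exists t.
by apply: ideal_gen_sub => _ [t /sBC Ct ->]; apply: ideal_gen_in; exists t.
Qed.

Lemma seg_ideal_eq n B C :
  (forall t, B t -> t <= n * g) -> (forall t, C t -> t <= n * g) ->
  ideal_eq (seg_ideal n B) (seg_ideal n C) <-> (forall t, B t <-> C t).
Proof.
move=> leB leC; split=> [eqBC t|eqBC p].
  by split; move: t;
    [apply/(seg_ideal_sub _ leB) | apply/(seg_ideal_sub _ leC)] => p /eqBC.
split; move: p; [apply/(seg_ideal_sub _ leB) | apply/(seg_ideal_sub _ leC)];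
  by move=> t /eqBC.
Qed.

End Segment.

(** * Sets of integers closed under addition modulo g *)

Lemma dvdn_big_gcd m (s : seq nat) :
  (m %| \big[gcdn/0]_(i <- s) i) = all (dvdn m) s.
Proof.
by elim: s => [|i s IHs]; rewrite ?big_nil ?dvdn0 // big_cons dvdn_gcd IHs.
Qed.

Lemma gcd_fset_dvd (A : {fset nat}) i : i \in A -> gcd_fset A %| i.
Proof. by apply/allP; rewrite -dvdn_big_gcd. Qed.

Lemma dvd_gcd_fset (A : {fset nat}) m :
  (forall i, i \in A -> m %| i) -> m %| gcd_fset A.
Proof. by move=> dvA; rewrite /gcd_fset dvdn_big_gcd; apply/allP. Qed.

Section SumClosed.
Variables (A : {fset nat}) (g : nat).
Hypotheses (g_gt0 : 0 < g) (A0 : 0 \in A) (Ag : g \in A).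
Hypothesis A_le : forall i, i \in A -> i <= g.

(** For A contained in [0, g] and containing 0 and g, this says that the residues
    of A modulo g are closed under addition. *)
Definition sum_closed :=
  forall i j, i \in A -> j \in A ->
    exists2 k, k \in A & i + j = k \/ i + j = g + k.

Lemma sum_closedD i j : sum_closed -> i \in A -> j \in A -> i + j <= g ->
  i + j \in A.
Proof.
move=> clA Ai Aj le_ij; have [k Ak [-> //|Dij]] := clA i j Ai Aj.
by have -> : i + j = g by lia.
Qed.

Lemma sum_closedB i j : sum_closed -> i \in A -> j \in A -> g <= i + j ->
  i + j - g \in A.
Proof.
move=> clA Ai Aj le_ij; have [k Ak [Dk|->]] := clA i j Ai Aj; last by rewrite addKn.
have -> : i + j - g = 0 by have := A_le Ak; lia.
by [].
Qed.

Lemma sum_closed_modMn e n : sum_closed -> e \in A -> (n * e) %% g \in A.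
Proof.
move=> clA Ae; elim: n => [|n IHn]; first by rewrite mul0n mod0n.
have lt_r : (n * e) %% g < g by rewrite ltn_mod.
rewrite mulSn -modnDmr; set r := (n * e) %% g in IHn lt_r *.
have [lt_g|le_g] := ltnP (e + r) g.
  by rewrite modn_small //; apply: sum_closedD => //; apply: ltnW.
rewrite -(subnK le_g) modnDr modn_small; last by have := A_le Ae; lia.
exact: sum_closedB.
Qed.

(** The least positive element e of A generates: g - e is congruent to
    (g - 1) e, so subtracting e from an element of A that is at least e
    stays in A, and minimality of e forces the remainders modulo e of the
    elements of A to be 0. *)
Lemma sum_closed_multiples : sum_closed ->
  forall i, i \in A <-> i <= g /\ gcd_fset A %| i.
Proof.
move=> clA; have exP : exists e, (e \in A) && (0 < e) by exists g; rewrite Ag.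
have [e /andP[Ae e_gt0] min_e] := ex_minnP exP.
have le_eg := A_le Ae.
have AeN : g - e \in A.
  have [<-|ne_eg] := eqVneq e g; first by rewrite subnn.
  have := sum_closed_modMn g.-1 clA Ae.
  suff -> : g.-1 * e = e.-1 * g + (g - e) by rewrite modnMDl modn_small //; lia.
  by nia.
have dv_e i : i \in A -> e %| i.
  elim/ltn_ind: i => i IHi Ai; have [->|i_gt0] := posnP i; first exact: dvdn0.
  have le_ei : e <= i by apply: min_e; rewrite Ai.
  rewrite -(subnK le_ei) dvdn_addl // IHi //; first by lia.
  have -> : i - e = i + (g - e) - g by lia.
  by apply: sum_closedB => //; lia.
have De : gcd_fset A = e.
  by apply/eqP; rewrite eqn_dvd gcd_fset_dvd //= dvd_gcd_fset.
rewrite De => i; split=> [Ai|[le_i /dvdnP[k Di]]]; first by rewrite A_le // dv_e.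
rewrite {i}Di in le_i *; elim: k le_i => [|k IHk] le_k; first by rewrite mul0n.
by rewrite mulSn in le_k *; apply: sum_closedD => //; apply: IHk; lia.
Qed.

Lemma multiples_sum_closed d : d %| g ->
  (forall i, i \in A <-> i <= g /\ d %| i) -> sum_closed.
Proof.
move=> dvg AE i j /AE[le_i dvi] /AE[le_j dvj].
have [le_ij|lt_g] := leqP (i + j) g.
  by exists (i + j); [apply/AE; rewrite dvdn_add | left].
exists (i + j - g); last by right; lia.
by apply/AE; split; [lia | rewrite dvdn_sub // dvdn_add].
Qed.

Lemma gcd_fset_eq_max : sum_closed ->
  gcd_fset A = g <-> (forall i, i \in A <-> i = 0 \/ i = g).
Proof.
move=> clA; have AE := sum_closed_multiples clA; split=> [Dg i|A0g].
  rewrite AE Dg; split=> [[le_i dv_i]|[->|->]]; rewrite ?dvdn0 //.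
  by have [->|i_gt0] := posnP i; [left | right; have := dvdn_leq i_gt0 dv_i; lia].
apply/eqP; rewrite eqn_dvd gcd_fset_dvd //= dvd_gcd_fset // => i /A0g[]->.
  exact: dvdn0.
exact: dvdnn.
Qed.

End SumClosed.

Theorem theorem3p2 (K : fieldType) (a b : nat) (A : {fset nat}) :
  0 < a -> 0 < b -> 1 < gcdn a b ->
  0 \in A -> gcdn a b \in A ->
  (forall i : nat, i \in A -> i <= gcdn a b) ->
  is_reduction_number (@ideal_xy K a b) (@ideal_of_set K a b A) 1 <->
  (let d := gcd_fset A in
   d <> gcdn a b /\
   (forall i : nat, i \in A <-> exists2 k : nat, k <= gcdn a b %/ d & i = k * d)).
Proof.
move=> a_gt0 b_gt0 g_gt1 A0 Ag A_le; cbv zeta; set d := gcd_fset A.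
set g := gcdn a b in g_gt1 Ag A_le *.
have g_gt0 : 0 < g by apply: ltnW.
have dg : d %| g by apply: gcd_fset_dvd.
have d_gt0 : 0 < d by apply: dvdn_gt0 dg.
set I := @ideal_of_set K a b A; set J := @ideal_xy K a b.
have IE : ideal_eq I (@seg_ideal K a b 1 (fun t => t \in A)) :=
  @ideal_of_setE K a b A.
have JE : ideal_eq J (@seg_ideal K a b 1 (fun t => t = 0 \/ t = g)) :=
  @ideal_xyE K a b.
have leA t : t \in A -> t <= 1 * g by rewrite mul1n; apply: A_le.
have le0g t : t = 0 \/ t = g -> t <= 1 * g by rewrite mul1n; case=> ->.
have I1 : ideal_eq (ideal_exp I 1) I := ideal_mul1 _.
have J1 : ideal_eq (ideal_mul J (ideal_exp I 0)) J := ideal_mul1 _.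
have eq01 : ideal_eq (ideal_exp I 1) (ideal_mul J (ideal_exp I 0)) <->
            (forall t, t \in A <-> t = 0 \/ t = g).
  apply: iff_trans (ideal_eq_congr (ideal_eq_trans I1 IE)
                                   (ideal_eq_trans J1 JE)) _.
  exact: seg_ideal_eq.
have II : ideal_eq (ideal_exp I 2) _ := ideal_eq_trans
  (ideal_mul_congr IE (ideal_eq_trans I1 IE))
  (@seg_ideal_mul K a b 1 1 _ _ leA leA).
have JI := ideal_eq_trans
  (ideal_mul_congr JE (ideal_eq_trans I1 IE))
  (@seg_ideal_mul K a b 1 1 _ _ le0g leA).
have eq12 : ideal_eq (ideal_exp I 2) (ideal_mul J (ideal_exp I 1)) <->
            sum_closed A g.
  apply: iff_trans (ideal_eq_congr II JI) _.
  rewrite seg_ideal_eq //; last 2 first.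
  - by move=> _ [i [j [/leA ? /leA ? ->]]]; lia.
  - by move=> _ [i [j [/le0g ? /leA ? ->]]]; lia.
  split=> [AA i j Ai Aj|clA t]; last split.
  - have [|u [k [Du Ak Dij]]] := (AA (i + j)).1; first by exists i, j.
    by exists k => //; case: Du Dij => ->; [left | right].
  - case=> i [j [Ai Aj ->]]; have [k Ak Dk] := clA i j Ai Aj.
    by case: Dk => ->; [exists 0, k | exists g, k]; split=> //; [left | right].
  - by case=> i [j [Di Aj ->]]; exists i, j; split=> //; case: Di => ->.
have multE : (forall i, i \in A <-> i <= g /\ d %| i) <->
    (forall i, i \in A <-> exists2 k, k <= g %/ d & i = k * d).
  suff E i : (i <= g /\ d %| i) <-> (exists2 k, k <= g %/ d & i = k * d).
    by split=> AE i; rewrite AE E.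
  split=> [[le_i /dvdnP[k Di]]|[k le_k ->]].
    by exists k; rewrite // leq_divRL // -Di.
  by rewrite -leq_divRL // dvdn_mull.
rewrite /is_reduction_number eq12 -multE; split=> [[clA min1]|[ne_dg AE]].
  split; last exact: sum_closed_multiples.
  by move/(gcd_fset_eq_max g_gt0 A0 Ag A_le clA)/eq01/min1.
have clA : sum_closed A g by apply: multiples_sum_closed AE.
split=> // -[|//] /eq01 A0g; case: ne_dg.
exact/(gcd_fset_eq_max g_gt0 A0 Ag A_le clA).
Qed.
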